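(* Let $(\mathfrak g,[\cdot,\cdots,\cdot]_{\mathfrak g},\alpha)$ be an $n$-Hom-Lie algebra and let $f\in C^1(\mathfrak g;\mathfrak g)=\mathrm{Hom}(\mathfrak g,\mathfrak g)$. Then $f$ is a $1$-cocycle with coefficients in the adjoint representation (i.e. $\delta f=0$) if and only if $f$ is a derivation of $\mathfrak g$.
   Context: All vector spaces are over an algebraically closed field $\mathbb K$ of characteristic $0$; $n\ge2$ is an integer. An $n$-Hom-Lie algebra $(\mathfrak g,[\cdot,\cdots,\cdot]_{\mathfrak g},\alpha)$ is a vector space $\mathfrak g$ with a linear map $[\cdot,\cdots,\cdot]_{\mathfrak g}:\wedge^n\mathfrak g\to\mathfrak g$ and an algebra automorphism $\alpha:\mathfrak g\to\mathfrak g$ (a linear bijection with $\alpha[x_1,\ldots,x_n]_{\mathfrak g}=[\alpha(x_1),\ldots,\alpha(x_n)]_{\mathfrak g}$) such that for all $x_1,\ldots,x_{n-1},y_1,\ldots,y_n\in\mathfrak g$ $$[\alpha(x_1),\ldots,\alpha(x_{n-1}),[y_1,\ldots,y_n]_{\mathfrak g}]_{\mathfrak g}=\sum_{i=1}^n[\alpha(y_1),\ldots,\alpha(y_{i-1}),[x_1,\ldots,x_{n-1},y_i]_{\mathfrak g},\alpha(y_{i+1}),\ldots,\alpha(y_n)]_{\mathfrak g}.$$ The adjoint representation is $(\mathfrak g,\mathrm{ad},\alpha)$ with $\mathrm{ad}_Xy=[x_1,\ldots,x_{n-1},y]_{\mathfrak g}$ for $X=x_1\wedge\cdots\wedge x_{n-1}$.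 The coboundary operator with coefficients in the adjoint representation is, on $1$-cochains $f:\mathfrak g\to\mathfrak g$, $$\begin{aligned}(\delta f)(x_1\wedge\cdots\wedge x_{n-1},z)=&-\alpha f\big([\alpha^{-2}(x_1),\ldots,\alpha^{-2}(x_{n-1}),\alpha^{-2}(z)]_{\mathfrak g}\big)+[x_1,\ldots,x_{n-1},f(\alpha^{-1}(z))]_{\mathfrak g}\\&+\sum_{i=1}^{n-1}(-1)^{n-i}[x_1,\ldots,\widehat{x_i},\ldots,x_{n-1},z,f(\alpha^{-1}(x_i))]_{\mathfrak g},\end{aligned}$$ where a hat means omission. A derivation of $\mathfrak g$ is a linear map $D\in\mathfrak{gl}(\mathfrak g)$ such that for all $x_1,\ldots,x_n\in\mathfrak g$ $$D[x_1,\ldots,x_n]_{\mathfrak g}=\sum_{i=1}^n[\alpha(x_1),\ldots,\alpha(x_{i-1}),(\alpha^{-1}\circ D\circ\alpha)(x_i),\alpha(x_{i+1}),\ldots,\alpha(x_n)]_{\mathfrak g}.$$ *)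

(* Defs.v *)
From HB Require Import structures.
From mathcomp Require Import all_boot all_order all_algebra.

Set Implicit Arguments.
Unset Strict Implicit.
Unset Printing Implicit Defensive.

Import GRing.Theory.
Local Open Scope ring_scope.

(* Families x_1, ..., x_n are finite functions on 'I_n, so indices are shifted
   by one: the x_i of the mathematical text is x applied to the ordinal i-1. *)

(* (x_1, ..., x_{i-1}, u, x_{i+1}, ..., x_n) *)
Definition subst_at (T : Type) (n : nat) (x : {ffun 'I_n -> T}) (i : 'I_n)
    (u : T) : {ffun 'I_n -> T} :=
  [ffun j => if j == i then u else x j].

(* (x_1, ..., x_{n-1}, z); only meaningful for 0 < n, the last index being the
   one j : 'I_n that does not lie in 'I_n.-1. *)
Definition append (T : Type) (n : nat) (x : {ffun 'I_n.-1 -> T}) (z : T) :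
    {ffun 'I_n -> T} :=
  [ffun j : 'I_n => if insub (val j) is Some i then x i else z].

(* (x_1, ..., x_{i-1}, x_{i+1}, ..., x_n) *)
Definition omit (T : Type) (n : nat) (x : {ffun 'I_n -> T}) (i : 'I_n) :
    {ffun 'I_n.-1 -> T} :=
  [ffun j => x (lift i j)].

Definition map_args (T U : Type) (n : nat) (h : T -> U) (x : {ffun 'I_n -> T}) :
    {ffun 'I_n -> U} :=
  [ffun j => h (x j)].

(* Linear maps on the n-th exterior power of g are represented by alternating
   multilinear maps on g^n. *)
Definition multilinear_map (K : fieldType) (g : lmodType K) (n : nat)
    (b : {ffun 'I_n -> g} -> g) : Prop :=
  forall (x : {ffun 'I_n -> g}) (i : 'I_n) (a : K) (u v : g),
    b (subst_at x i (a *: u + v)) = a *: b (subst_at x i u) + b (subst_at x i v).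

Definition alternating_map (K : fieldType) (g : lmodType K) (n : nat)
    (b : {ffun 'I_n -> g} -> g) : Prop :=
  forall (x : {ffun 'I_n -> g}) (i j : 'I_n), i != j -> x i = x j -> b x = 0.

(* alphaV is the inverse of the automorphism alpha. *)
Record nHomLie (K : fieldType) (n : nat) (g : lmodType K) := NHomLie {
  bracket : {ffun 'I_n -> g} -> g;
  alpha : {linear g -> g};
  alphaV : g -> g;
  bracket_multilinear : multilinear_map bracket;
  bracket_alternating : alternating_map bracket;
  alphaK : cancel alpha alphaV;
  alphaVK : cancel alphaV alpha;
  alpha_bracket : forall x, alpha (bracket x) = bracket (map_args alpha x);
  hom_jacobi : forall (x : {ffun 'I_n.-1 -> g}) (y : {ffun 'I_n -> g}),
    bracket (append (map_args alpha x) (bracket y)) =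
    \sum_(i < n)
      bracket (subst_at (map_args alpha y) i (bracket (append x (y i))))
}.

Section Cohomology.
Variables (K : fieldType) (n : nat) (g : lmodType K) (L : nHomLie n g).

Local Notation "[[ x ]]" := (bracket L x) (at level 0, x at level 200).
Local Notation al := (alpha L).
Local Notation alV := (alphaV L).

Definition ad (X : {ffun 'I_n.-1 -> g}) (y : g) : g := [[append X y]].

(* With i 0-based, the sign (-1)^(n-i) becomes (-1)^(n-(i+1)), and the family
   x_1, ..., ^x_i, ..., x_{n-1}, z is (x_1, ..., x_{n-1}, z) with its i-th entry
   omitted. *)
Definition coboundary1 (f : {linear g -> g}) (x : {ffun 'I_n.-1 -> g}) (z : g) :
    g :=
  - al (f (ad (map_args (alV \o alV) x) (alV (alV z))))
  + ad x (f (alV z))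
  + \sum_(i < n.-1)
      (-1) ^+ (n - i.+1) *:
        ad (omit (append x z) (widen_ord (leq_pred n) i)) (f (alV (x i))).

Definition is_cocycle1 (f : {linear g -> g}) : Prop :=
  forall (x : {ffun 'I_n.-1 -> g}) (z : g), coboundary1 f x z = 0.

Definition is_derivation (D : {linear g -> g}) : Prop :=
  forall x : {ffun 'I_n -> g},
    D [[x]] = \sum_(i < n) [[subst_at (map_args al x) i (alV (D (al (x i))))]].

End Cohomology.

(* Main.v *)
Require Import Defs.
From mathcomp Require Import all_boot all_order all_fingroup all_algebra.

(** Write w = (x_1, ..., x_{n-1}, z) and w = alpha^2 y. Moving f (alpha^-1 x_i)
   back from the last place to the i-th place costs the sign (-1)^(n-i), so the
   last two parts of the coboundary add up to the sum over all n indices of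
   [w_1, ..., f (alpha^-1 w_i), ..., w_n]. The coboundary is therefore alpha
   applied to the derivation defect of f at y, and alpha is bijective. *)

Set Implicit Arguments.
Unset Strict Implicit.
Unset Printing Implicit Defensive.

Import GRing.Theory.
Local Open Scope ring_scope.

Section Families.
Variables (T : Type) (n : nat).
Implicit Types (x : {ffun 'I_n -> T}) (u v : T) (i j : 'I_n).

Lemma subst_at_id x i : subst_at x i (x i) = x.
Proof. by apply/ffunP=> k; rewrite ffunE; case: eqP => [->|]. Qed.

Lemma subst_atC x i j u v : i != j ->
  subst_at (subst_at x i u) j v = subst_at (subst_at x j v) i u.
Proof.
by move=> nij; apply/ffunP=> k; rewrite !ffunE; case: eqP => [->|//];
  rewrite eq_sym (negPf nij).
Qed.

Lemma append_lift (x : {ffun 'I_n -> T}) (z : T) (i : 'I_n) :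
  append (n := n.+1) x z (lift ord_max i) = x i.
Proof.
by rewrite ffunE /= /bump leqNgt ltn_ord valK.
Qed.

Lemma append_max (x : {ffun 'I_n -> T}) (z : T) :
  append (n := n.+1) x z ord_max = z.
Proof. by rewrite ffunE insubF //= ltnn. Qed.

Lemma append_omit_max (w : {ffun 'I_n.+1 -> T}) u :
  append (omit w ord_max) u = subst_at w ord_max u.
Proof.
apply/ffunP=> k; case: (unliftP ord_max k) => [j|] ->.
  by rewrite append_lift !ffunE eq_sym (negPf (neq_lift _ _)).
by rewrite append_max ffunE eqxx.
Qed.

(** [lift_perm ord_max i 1] is the cycle sending the last position to [i] and keeping the order of
    the others. This form puts the sign within reach of [alternating_perm]. *)
Lemma append_omit (w : {ffun 'I_n.+1 -> T}) (i : 'I_n.+1) u :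
  append (omit w i) u =
    [ffun k => subst_at w i u (lift_perm ord_max i 1%g k)].
Proof.
apply/ffunP=> k; rewrite [RHS]ffunE; case: (unliftP ord_max k) => [j|] ->.
  by rewrite append_lift lift_perm_lift perm1 !ffunE eq_sym (negPf (neq_lift _ _)).
by rewrite append_max lift_perm_id ffunE eqxx.
Qed.

End Families.

Section Alternating.
Variables (K : fieldType) (g : lmodType K) (n : nat) (b : {ffun 'I_n -> g} -> g).
Hypotheses (lin_b : multilinear_map b) (alt_b : alternating_map b).
Implicit Types (x : {ffun 'I_n -> g}).

Lemma multilinear_add x i u v :
  b (subst_at x i (u + v)) = b (subst_at x i u) + b (subst_at x i v).
Proof. by have := lin_b x i 1 u v; rewrite !scale1r. Qed.

(** Polarization: as a function [F] of slots [i] and [j] alone, [b] is biadditive and zero on the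
    diagonal; expand [F (x i + x j) (x i + x j) = 0]. *)
Lemma alternating_tperm x (i j : 'I_n) : i != j ->
  b [ffun k => x (tperm i j k)] = - b x.
Proof.
move=> nij; pose F u v := b (subst_at (subst_at x i u) j v).
have FDr u v w : F u (v + w) = F u v + F u w by exact: multilinear_add.
have FDl u v w : F (u + v) w = F u w + F v w.
  by rewrite /F !(subst_atC x _ _ nij) multilinear_add.
have F0 u : F u u = 0.
  by apply: (alt_b nij); rewrite !ffunE !eqxx (negPf nij).
have -> : b [ffun k => x (tperm i j k)] = F (x j) (x i).
  congr b; apply/ffunP=> k; rewrite !ffunE.
  case: tpermP => [->|->|/eqP/negPf-> /eqP/negPf-> //]; last by rewrite eqxx.
  by rewrite (negPf nij) eqxx.
have -> : b x = F (x i) (x j).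
  rewrite /F subst_at_id; congr b; apply/esym/subst_at_id.
apply/eqP; rewrite -addr_eq0; apply/eqP.
by have := F0 (x i + x j); rewrite FDr !FDl !F0 add0r addr0.
Qed.

Lemma alternating_perm (s : {perm 'I_n}) x :
  b [ffun k => x (s k)] = (-1) ^+ s *: b x.
Proof.
have [ts -> /=] := prod_tpermP s.
elim: ts x => [|t ts IHts] x /=.
  rewrite big_nil odd_perm1 scale1r => _; congr b.
  by apply/ffunP=> k; rewrite ffunE perm1.
case/andP=> nt dts; rewrite big_cons odd_permM odd_tperm nt signr_addb expr1.
rewrite mulN1r scaleNr -(IHts x dts) -(alternating_tperm _ nt).
by congr b; apply/ffunP=> k; rewrite !ffunE permM.
Qed.

End Alternating.

(** The cycle from [append_omit] has the parity of [m + i], hence of [m - i], so its sign cancels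
    the one in front. *)
Lemma alternating_append_omit (K : fieldType) (g : lmodType K) (m : nat)
    (b : {ffun 'I_m.+1 -> g} -> g) (lin_b : multilinear_map b)
    (alt_b : alternating_map b) (w : {ffun 'I_m.+1 -> g}) (i : 'I_m.+1) (u : g) :
  (-1) ^+ (m - i) *: b (append (omit w i) u) = b (subst_at w i u).
Proof.
rewrite append_omit alternating_perm // odd_lift_perm odd_perm1 addbF scalerA.
by rewrite -oddB ?leq_ord // signr_odd -exprMn mulrNN mulr1 expr1n scale1r.
Qed.

Section Coboundary.
Variables (K : fieldType) (m : nat) (g : lmodType K) (L : nHomLie m.+1 g).
Variable f : {linear g -> g}.
Local Notation al := (alpha L).
Local Notation alV := (alphaV L).

Lemma coboundary1E (x : {ffun 'I_m -> g}) (z : g) :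
  let w := append (n := m.+1) x z in
  coboundary1 L f x z =
    - al (f (bracket L (map_args (alV \o alV) w)))
    + \sum_(i < m.+1) bracket L (subst_at w i (f (alV (w i)))).
Proof.
move=> w; rewrite /coboundary1 -addrA; congr (_ + _).
  congr (- al (f (bracket L _))); apply/ffunP=> k.
  case: (unliftP ord_max k) => [j|] ->.
    by rewrite append_lift [RHS]ffunE append_lift ffunE.
  by rewrite append_max [RHS]ffunE append_max.
(* The last index of the full sum gives the unsigned term [ad x (f (alV z))]; the remaining indices
   match the signed terms one by one. *)
rewrite big_ord_recr addrC /=; congr (_ + _).
  apply: eq_bigr => i _; set i' := widen_ord _ i.
  (* The two embeddings of [i] differ only in their proofs of [m <= m.+1]. *)
  have -> : widen_ord (leqnSn m) i = i' by apply: val_inj.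
  have wi : w i' = x i.
    by rewrite -(append_lift x z i); congr (w _); apply: val_inj; rewrite /= /bump leqNgt ltn_ord.
  rewrite wi subSS /ad.
  exact: alternating_append_omit (bracket_multilinear L) (bracket_alternating L) w i' _.
rewrite append_max -append_omit_max /ad; congr (bracket L (append _ _)).
by apply/ffunP=> k; rewrite ffunE append_lift.
Qed.

(** Once [al] is inside the bracket, it cancels [alV] in slot [i], leaving [f (al (y i))], and
    [al (y i)] is [alV (w i)]. *)
Lemma alpha_derivation_sum (y : {ffun 'I_m.+1 -> g}) :
  let w := map_args (al \o al) y in
  al (\sum_(i < m.+1) bracket L (subst_at (map_args al y) i (alV (f (al (y i)))))) =
    \sum_(i < m.+1) bracket L (subst_at w i (f (alV (w i)))).
Proof.
rewrite raddf_sum; apply: eq_bigr => i _; rewrite /= alpha_bracket.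
congr (bracket L _); apply/ffunP=> k; rewrite !ffunE /= alphaK.
by case: eqP => // _; rewrite alphaVK.
Qed.

Lemma cocycle1_derivation : is_cocycle1 L f <-> is_derivation L f.
Proof.
split=> [cocf y | derf x z].
  apply: (can_inj (alphaK L)); rewrite alpha_derivation_sum.
  set w := map_args (al \o al) y.
  (* Splitting off the last entry writes any [w] as cochain arguments, so the cocycle condition
     applies to it. *)
  have wE : append (n := m.+1) (omit w ord_max) (w ord_max) = w.
    by rewrite append_omit_max subst_at_id.
  have := cocf (omit w ord_max) (w ord_max); rewrite coboundary1E wE => /eqP.
  rewrite addrC subr_eq0 => /eqP ->.
  congr (al (f (bracket L _))); apply/ffunP=> k.
  by rewrite !ffunE /= !alphaK.
rewrite coboundary1E; set w := append _ _.
(* The derivation identity is used at the family [alV (alV (w k))], whose image under [al \o al] is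
   [w]. *)
rewrite derf alpha_derivation_sum.
have -> : map_args (al \o al) (map_args (alV \o alV) w) = w.
  by apply/ffunP=> k; rewrite !ffunE /= !alphaVK.
by rewrite addNr.
Qed.

End Coboundary.

Theorem proposition3p6 (K : closedFieldType) (charK : [pchar K] =i pred0)
    (n : nat) (hn : (2 <= n)%N) (g : lmodType K) (L : nHomLie n g)
    (f : {linear g -> g}) :
  is_cocycle1 L f <-> is_derivation L f.
(* Since [n] is positive it has the form [m.+1], so that a last index [ord_max] exists. *)
Proof. by case: n hn L => // m _ L; apply: cocycle1_derivation. Qed.
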